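(* Let $\tau,k\geq 1$ be integers. Let $D=(V,A)$ be a digraph such that $$d_A^+(U)+\left(\tfrac{\tau}{k}-1\right)d_A^-(U)\geq \tau\quad\text{for all } U\subsetneq V,\ U\neq\emptyset.$$ Let $\mathcal{C}$ be a crossing family over ground set $V$, and let $f:\mathcal{C}\to\mathbb{Z}$ be a crossing submodular function such that $$f(U)\geq \tfrac{k}{\tau}\left(d_A^+(U)-d_A^-(U)\right)\quad\text{for all } U\in\mathcal{C}.$$ Then $D$ has a $k$-arc-connected flip $J\subseteq A$ such that $f(U)\geq d_J^+(U)-d_J^-(U)$ for all $U\in\mathcal{C}$.
   Context: Digraphs are finite and may have parallel arcs. For a digraph $D=(V,A)$ and $U\subseteq V$, $\delta^+(U)$ and $\delta^-(U)$ denote the sets of arcs of $D$ leaving and entering $U$, respectively. For $J\subseteq A$, $d_J^+(U):=|\delta^+(U)\cap J|$ and $d_J^-(U):=|\delta^-(U)\cap J|$. A $k$-arc-connected flip of $D$ (for an integer $k\ge 1$) is a subset $J\subseteq A$ such that after reversing the arcs of $J$ the digraph becomes (strongly) $k$-arc-connected, i.e. $d_J^+(U)+d_A^-(U)-d_J^-(U)\geq k$ for all $U\subsetneq V$, $U\neq\emptyset$. A family $\mathcal{C}$ of subsets of $V$ is a crossing family over ground set $V$ if for all $U,W\in\mathcal{C}$ with $U\cap W\neq\emptyset$ and $U\cup W\neq V$ we have $U\cap W,\,U\cup W\in\mathcal{C}$. A function $f:\mathcal{C}\to\mathbb{R}$ is crossing submodular over $\mathcal{C}$ if $f(U\cap W)+f(U\cup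 W)\leq f(U)+f(W)$ for all $U,W\in\mathcal{C}$ with $U\cap W\neq\emptyset$ and $U\cup W\neq V$. *)

(* Defs.v *)
From mathcomp Require Import all_boot all_order all_algebra.

Set Implicit Arguments.
Unset Strict Implicit.
Unset Printing Implicit Defensive.

Import Order.TTheory GRing.Theory Num.Theory.
Local Open Scope ring_scope.

(* Arcs form a type of their own, so parallel arcs are allowed. Loops are not
   excluded; they belong to no cut. *)
Record digraph := Digraph {
  vert : finType;
  darc : finType;
  src : darc -> vert;
  tgt : darc -> vert }.

Definition cut_out (D : digraph) (U : {set vert D}) : {set darc D} :=
  [set a | (src a \in U) && (tgt a \notin U)].

Definition cut_in (D : digraph) (U : {set vert D}) : {set darc D} :=
  [set a | (src a \notin U) && (tgt a \in U)].

Definition deg_out (D : digraph) (J : {set darc D}) (U : {set vert D}) : nat :=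
  #|cut_out U :&: J|.

Definition deg_in (D : digraph) (J : {set darc D}) (U : {set vert D}) : nat :=
  #|cut_in U :&: J|.

Definition reverse_arcs (D : digraph) (J : {set darc D}) : digraph :=
  @Digraph (vert D) (darc D)
    (fun a => if a \in J then tgt a else src a)
    (fun a => if a \in J then src a else tgt a).

(* Since U ranges over a family closed under complement, bounding the arcs
   entering every U is the same as bounding those leaving every U. *)
Definition arc_connected (k : nat) (D : digraph) : Prop :=
  forall U : {set vert D}, U != set0 -> U \proper [set: vert D] ->
    (k <= deg_in [set: darc D] U)%N.

Definition arc_connected_flip (k : nat) (D : digraph) (J : {set darc D}) : Prop :=
  arc_connected k (reverse_arcs J).

Lemma deg_in_reverse (D : digraph) (J : {set darc D}) (U : {set vert D}) :
  (@deg_in (reverse_arcs J) [set: darc (reverse_arcs J)] U)%:Z =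
  (deg_out J U)%:Z + (deg_in [set: darc D] U)%:Z - (deg_in J U)%:Z.
Proof.
pose E := @cut_in (reverse_arcs J) U.
have EJ : E :&: J = cut_out U :&: J.
  by apply/setP=> a; rewrite !inE /=; case: (a \in J); [congr andb; rewrite andbC | rewrite !andbF].
have EDJ : E :\: J = cut_in U :\: J.
  by apply/setP=> a; rewrite !inE /=; case: (a \in J).
have -> : @deg_in (reverse_arcs J) [set: darc (reverse_arcs J)] U = #|E| by rewrite /deg_in setIT.
rewrite -(cardsID J E) EJ EDJ /deg_in setIT -(cardsID J (cut_in U)) !PoszD.
by rewrite -addrA [X in X - _]addrC addrK.
Qed.

Lemma arc_connected_flipP (k : nat) (D : digraph) (J : {set darc D}) :
  arc_connected_flip k J <->
  (forall U : {set vert D}, U != set0 -> U \proper [set: vert D] ->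
     k%:Z <= (deg_out J U)%:Z + (deg_in [set: darc D] U)%:Z - (deg_in J U)%:Z).
Proof.
by split=> H U U0 UT; have := H U U0 UT; rewrite -deg_in_reverse lez_nat.
Qed.

Definition crossing_family (V : finType) (C : {set {set V}}) : Prop :=
  forall U W : {set V}, U \in C -> W \in C ->
    U :&: W != set0 -> U :|: W != [set: V] ->
    U :&: W \in C /\ U :|: W \in C.

(* A function on C is given as a total function on {set V}; its values outside
   C are irrelevant. *)
Definition crossing_submodular (V : finType) (R : numDomainType)
    (C : {set {set V}}) (f : {set V} -> R) : Prop :=
  forall U W : {set V}, U \in C -> W \in C ->
    U :&: W != set0 -> U :|: W != [set: V] ->
    f (U :&: W) + f (U :|: W) <= f U + f W.

(* Main.v *)
Require Import Defs.
From mathcomp Require Import all_boot all_order all_algebra.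
From mathcomp Require Import zify ring.

Set Implicit Arguments.
Unset Strict Implicit.
Unset Printing Implicit Defensive.

Import Order.TTheory GRing.Theory Num.Theory.
Local Open Scope ring_scope.

(** Only the net outflow [y v] of the flip at each vertex [v] matters, since
    the net outflow of a set of vertices is the sum of those of its elements.
    In these terms the flip [J] has to satisfy [y(U) <= f U] for [U] in [C] and,
    applying the connectivity condition to complements,
    [y(U) <= g U := d^+(U) - k] for all nonempty proper [U]; moreover [y(V) = 0].
    Both [f] and [g] are crossing submodular.  Conversely, as [g <= d^+], any
    integral [y] satisfying the second system is the net outflow of some set of
    arcs ([net_outflow_realizable]).  So an integral point is needed in the
    intersection of two crossing base polyhedra.  The rational vector
    [k/tau * (d^+(v) - d^-(v))] belongs to it: for [f] this is the hypothesis on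
    [f], for [g] it is the cut condition applied to the complement.

    The remaining point is that such an intersection, if it is nonempty, has an
    integral point ([crossing_intersection_integral]).  At a point [y], the sets
    of the first family at which the inequality is tight form a crossing family
    ([tight_crossing]), and so do those of the second.  The atoms of a
    crossing family have their indicator vectors in the integral span of the
    indicators of its members and of the ground set ([sum_atom_closed]); hence
    every atom of either tight family has an integral sum, and so contains either
    no fractional coordinate or at least two.  View the fractional
    coordinates as the edges of a bipartite graph between the atoms of the two
    families: all degrees of its non-isolated vertices are at least two, so
    there is a nonzero weighting of the edges with sum zero at every vertex
    ([null_fibre_sums_nontrivial]).  Moving [y] along this weighting keeps
    every tight inequality tight, and the movement can go on until a new
    inequality becomes tight.  Boxing each coordinate between two consecutive
    integers forces this to happen, and to end with an integral point
    ([polyhedron_descent]). *)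

(** * Atoms of a crossing family *)

Lemma sum_setU_setI (V : finType) (R : zmodType) (s : V -> R)
    (X Y : {set V}) :
  \sum_(x in X :&: Y) s x + \sum_(x in X :|: Y) s x =
  \sum_(x in X) s x + \sum_(x in Y) s x.
Proof.
rewrite [X in _ + X = _](big_setID X) /= setIC setUK setDUl setDv set0U addrCA.
by congr (_ + _); rewrite [RHS](big_setID X) setIC.
Qed.

Lemma sum_setC (V : finType) (R : zmodType) (s : V -> R) (X : {set V}) :
  \sum_(x in ~: X) s x = \sum_x s x - \sum_(x in X) s x.
Proof.
rewrite [\sum_x s x](bigID [in X]) /= addrAC subrr add0r.
by apply: eq_bigl => x; rewrite inE.
Qed.

Definition meeting_closed (V : finType) (P : {set {set V}}) : Prop :=
  forall A B, A \in P -> B \in P -> A :&: B != set0 -> A :|: B \in P.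

(** The maximal members do: if two of them met, their union would be a larger
    member. *)
Lemma meeting_closed_disjoint_cover (V : finType) (P : {set {set V}}) :
  meeting_closed P ->
  exists Q : {set {set V}}, [/\ Q \subset P, trivIset Q & cover Q = cover P].
Proof.
move=> Pmeet; exists [set A | maxset (mem P) A]; split.
- by apply/subsetP=> A; rewrite inE => /maxsetP[].
- apply/trivIsetP=> A B; rewrite !inE => /maxsetP[PA maxA] /maxsetP[PB maxB] AB.
  rewrite -setI_eq0; apply: contraNT AB => AB0.
  have PU := Pmeet A B PA PB AB0.
  by rewrite -(maxA _ PU (subsetUl _ _)) -{2}(maxB _ PU (subsetUr _ _)).
- apply/setP=> x; apply/bigcupP/bigcupP => -[A].
    by rewrite inE => /maxsetP[PA _] xA; exists A.
  move=> PA xA; have [B maxB sAB] := maxset_exists (P := mem P) PA.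
  by exists B; rewrite ?inE // (subsetP sAB).
Qed.

Lemma sum_cover_closed (V : finType) (R : zmodType) (S : zmodClosed R)
    (s : V -> R) (Q : {set {set V}}) (Y : {set V}) :
  trivIset Q -> (forall A, A \in Q -> \sum_(x in A :&: Y) s x \in S) ->
  \sum_(x in cover Q :&: Y) s x \in S.
Proof.
move=> triv QS.
have -> : \sum_(x in cover Q :&: Y) s x =
          \sum_(x in cover Q | x \in Y) s x.
  by apply: eq_bigl => x; rewrite inE.
rewrite big_trivIset_cond //.
apply: rpred_sum => A QA; have := QS A QA; congr (_ \in S).
by apply: eq_bigl => x; rewrite inE.
Qed.

Definition atom (V : finType) (F : {set {set V}}) (v : V) : {set V} :=
  [set w | [forall U in F, (w \in U) == (v \in U)]].

Lemma atomP (V : finType) (F : {set {set V}}) (v w : V) :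
  reflect (forall U, U \in F -> (w \in U) = (v \in U)) (w \in atom F v).
Proof.
by rewrite inE; apply: (iffP forall_inP) => H U FU; apply/eqP; rewrite H.
Qed.

Lemma atom_id (V : finType) (F : {set {set V}}) (v : V) : v \in atom F v.
Proof. exact/atomP. Qed.

Lemma eq_atom (V : finType) (F : {set {set V}}) (v w : V) :
  (atom F w == atom F v) = (w \in atom F v).
Proof.
apply/eqP/idP => [<- | /atomP wv]; first exact: atom_id.
by apply/setP=> x; apply/atomP/atomP => H U FU; rewrite H // wv.
Qed.

(** The complement of the atom of [v] is the union of the members of [F] that
    avoid [v] and of the complements of those that contain [v].  Either of
    these two families is closed under unions of meeting sets, so its union is
    a disjoint union of members, whose sums lie in [S].  The two unions
    intersect in the disjoint union of the sets [A :&: ~: B], where [A] avoids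
    [v] and [B] contains it; the sum over such a set lies in [S] because
    [A] and [B] either cross, so that [A :&: B] is in [F], or are disjoint, or
    cover the ground set.  Inclusion-exclusion concludes. *)
Lemma sum_atom_closed (V : finType) (R : zmodType) (S : zmodClosed R)
    (s : V -> R) (F : {set {set V}}) (v : V) :
  crossing_family F -> \sum_x s x \in S ->
  (forall U, U \in F -> \sum_(x in U) s x \in S) ->
  \sum_(x in atom F v) s x \in S.
Proof.
move=> crossF ST SF.
pose P := [set U in F | v \notin U].
pose N := [set ~: U | U in F & v \in U].
have Pmeet : meeting_closed P.
  move=> A B; rewrite !inE => /andP[FA vA] /andP[FB vB] AB0.
  have [|_ FU] := crossF A B FA FB AB0; last by rewrite FU negb_or vA.
  by apply: contraNneq vA => AB; have := in_setT v; rewrite -AB inE (negPf vB) orbF.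
have Nmeet : meeting_closed N.
  move=> _ _ /imsetP[A /[!inE] /andP[FA vA] ->] /imsetP[B /[!inE] /andP[FB vB] ->].
  rewrite -setCU -setCI => AB0; apply: imset_f; rewrite !inE vA vB !andbT.
  have AB : A :&: B != set0 by apply/set0Pn; exists v; rewrite inE vA.
  have ABT : A :|: B != setT by apply: contraNneq AB0 => ->; rewrite setCT.
  by have [] := crossF A B FA FB AB ABT.
have [P' [sP' trivP' covP']] := meeting_closed_disjoint_cover Pmeet.
have [N' [sN' trivN' covN']] := meeting_closed_disjoint_cover Nmeet.
have SP A : A \in P' -> \sum_(x in A) s x \in S.
  by move/(subsetP sP'); rewrite inE => /andP[/SF].
have SN A : A \in N' -> \sum_(x in A) s x \in S.
  move/(subsetP sN')=> /imsetP[B /[!inE] /andP[FB _] ->].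
  by rewrite sum_setC rpredB // SF.
have SPN A B : A \in P' -> B \in N' -> \sum_(x in A :&: B) s x \in S.
  move=> PA /(subsetP sN') /imsetP[B' /[!inE] /andP[FB vB] ->].
  have := subsetP sP' _ PA; rewrite inE => /andP[FA vA].
  have [A0|AB0] := eqVneq (A :&: B') set0.
    by rewrite -setDE (setDidPl _) ?SP // -setI_eq0 A0.
  have [AT|ABT] := eqVneq (A :|: B') setT.
    have -> : A :&: ~: B' = ~: B'.
      apply/setIidPr/subsetP=> x; rewrite inE => xB.
      by have := in_setT x; rewrite -AT inE (negPf xB) orbF.
    by rewrite sum_setC rpredB // SF.
  have [FI _] := crossF A B' FA FB AB0 ABT.
  have -> : \sum_(x in A :&: ~: B') s x =
            \sum_(x in A) s x - \sum_(x in A :&: B') s x.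
    by rewrite [X in X - _](big_setID B') addrC addKr setDE.
  by rewrite rpredB ?SF.
have Scov Q : trivIset Q -> (forall A, A \in Q -> \sum_(x in A) s x \in S) ->
    \sum_(x in cover Q) s x \in S.
  move=> trivQ SQ; rewrite -[cover Q]setIT; apply: sum_cover_closed => // A QA.
  by rewrite setIT SQ.
have -> : atom F v = ~: (cover P :|: cover N).
  apply/setP=> w; apply/atomP/idP => [H|].
    rewrite !inE negb_or; apply/andP; split; apply/bigcupP => -[A].
      by rewrite inE => /andP[FA vA]; rewrite H // (negPf vA).
    by case/imsetP=> B /[!inE] /andP[FB vB] ->; rewrite inE H // vB.
  rewrite !inE negb_or => /andP[wP wN] U FU.
  case: (boolP (v \in U)) => vU.
    apply: contraNT wN => wU; apply/bigcupP; exists (~: U); rewrite ?inE //.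
    by apply: imset_f; rewrite inE FU.
  apply: contraNF wP => wU; apply/bigcupP; exists U => //; rewrite inE FU //.
have E := sum_setU_setI s (cover P) (cover N).
rewrite sum_setC rpredB //.
rewrite -[X in X \in _](addKr (\sum_(x in cover P :&: cover N) s x)) E.
rewrite -covP' -covN' rpredD ?rpredN ?rpredD ?Scov //.
apply: sum_cover_closed => // A PA; rewrite setIC.
by apply: sum_cover_closed => // B NB; rewrite setIC SPN.
Qed.

(** * Descent to a point with more tight inequalities *)

Definition dot (V : finType) (R : fieldType) (a y : V -> R) : R := \sum_v a v * y v.

Lemma dotDZr (V : finType) (R : fieldType) (a y z : V -> R) (t : R) :
  dot a (fun v => y v + t * z v) = dot a y + t * dot a z.
Proof.
rewrite /dot mulr_sumr -big_split; apply: eq_bigr => v _.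
by rewrite mulrDr mulrCA.
Qed.

(** Move from [y] in direction [z] until the first inequality whose left-hand
    side increases becomes tight. *)
Lemma more_tight (V I : finType) (R : realFieldType)
    (a : I -> V -> R) (b : I -> R) (y z : V -> R) (j : I) :
  (forall i, dot (a i) y <= b i) ->
  (forall i, dot (a i) y = b i -> dot (a i) z = 0) ->
  0 < dot (a j) z ->
  exists y', (forall i, dot (a i) y' <= b i) /\
    [set i | dot (a i) y == b i] \proper [set i | dot (a i) y' == b i].
Proof.
move=> feas perp zj.
pose ratio i := (b i - dot (a i) y) / dot (a i) z.
case: (arg_minP ratio (zj : (fun i => 0 < dot (a i) z) j)) => m zm min_m.
exists (fun v => y v + ratio m * z v); split.
  move=> i; rewrite dotDZr -lerBrDl.
  have [zi|zi] := ltP 0 (dot (a i) z).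
    by rewrite -ler_pdivlMr // min_m.
  apply: (@le_trans _ _ 0); last by rewrite subr_ge0.
  by apply: mulr_ge0_le0 zi; apply: divr_ge0; rewrite ?subr_ge0 // ltW.
apply/properP; split.
  apply/subsetP=> i; rewrite !inE dotDZr => /eqP ti.
  by rewrite (perp i ti) mulr0 addr0 ti.
exists m; rewrite inE ?dotDZr.
  by rewrite divfK ?(gt_eqF zm) // addrC subrK eqxx.
by apply: contraTneq zm => /perp ->; rewrite ltxx.
Qed.

(** Each step adds a tight inequality, so finitely many steps reach a point with
    property [Q]. *)
Lemma polyhedron_descent (V I : finType) (R : realFieldType)
    (a : I -> V -> R) (b : I -> R) (Q : (V -> R) -> Prop) :
  (forall y, (forall i, dot (a i) y <= b i) ->
     Q y \/ exists z j, (forall i, dot (a i) y = b i -> dot (a i) z = 0) /\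
                        0 < dot (a j) z) ->
  forall y, (forall i, dot (a i) y <= b i) ->
  exists y', (forall i, dot (a i) y' <= b i) /\ Q y'.
Proof.
move=> step y; have [n] := ubnP #|~: [set i | dot (a i) y == b i]|.
elim: n y => // n IHn y ltn feas.
have [Qy|[z [j [perp zj]]]] := step y feas; first by exists y.
have [y' [feas' tight]] := more_tight feas perp zj.
apply: (IHn y') => //; rewrite -ltnS (leq_trans _ ltn) // ltnS.
by rewrite proper_card // properC.
Qed.

(** * A nonzero weighting with vanishing fibre sums *)

Lemma card_imset_double (T L : finType) (p : T -> L) (E : {set T}) :
  (forall e, e \in E -> exists2 e', e' \in E & e' != e /\ p e' = p e) ->
  (#|p @: E| * 2 <= #|E|)%N.
Proof.
move=> H; rewrite -[leqRHS]sum1_card (partition_big_imset p) -sum_nat_const /=.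
apply: leq_sum => _ /imsetP[e Ee ->].
have [e' Ee' [ne pe]] := H e Ee.
rewrite (bigD1 e) ?Ee ?eqxx //= (bigD1 e') ?Ee' ?ne ?pe ?eqxx //.
Qed.

(** The elements of [E] are the edges of a bipartite graph joining [p e] to
    [q e].  Minimum degree two yields at most as many vertices as edges, and the
    conditions at the vertices are linearly dependent: adding them up on either
    side gives the total weight.  So there are fewer independent conditions
    than unknowns. *)
Lemma null_fibre_sums_nontrivial (T L1 L2 : finType) (K : fieldType)
    (p : T -> L1) (q : T -> L2) (E : {set T}) :
  E != set0 ->
  (forall e, e \in E -> exists2 e', e' \in E & e' != e /\ p e' = p e) ->
  (forall e, e \in E -> exists2 e', e' \in E & e' != e /\ q e' = q e) ->
  exists z : T -> K, [/\ forall e, e \notin E -> z e = 0,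
    exists e, z e != 0,
    forall l, \sum_(e | p e == l) z e = 0 &
    forall l, \sum_(e | q e == l) z e = 0].
Proof.
move=> E0 Hp Hq.
pose m1 := #|p @: E|; pose m2 := #|q @: E|; pose n := #|E|.
pose ev (i : 'I_n) : T := enum_val i.
pose M1 : 'M[K]_(n, m1) := \matrix_(i, j) (p (ev i) == enum_val j)%:R.
pose M2 : 'M[K]_(n, m2) := \matrix_(i, j) (q (ev i) == enum_val j)%:R.
pose M := row_mx M1 M2.
have evE i : ev i \in E := enum_valP i.
have [e0 e0E] := set0Pn _ E0.
have row_sum (L : finType) (r : T -> L) :
    \matrix_(i < n, j < #|r @: E|) (r (ev i) == enum_val j)%:R *m const_mx 1 =
    const_mx 1 :> 'cV[K]_n.
  apply/matrixP=> i c; rewrite !mxE.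
  have rE : r (ev i) \in r @: E by apply: imset_f.
  rewrite (bigD1 (enum_rank_in rE (r (ev i)))) //= !mxE enum_rankK_in // eqxx mul1r.
  rewrite big1 ?addr0 // => j nj; rewrite !mxE.
  case: eqP => [rj|]; last by rewrite mul0r.
  by case/eqP: nj; apply: enum_val_inj; rewrite enum_rankK_in.
(* The incidence matrix sends the vector that is 1 on one side and -1 on the
   other to 0. *)
have notfull : ~~ row_full M.
  apply/negP=> full.
  have /(row_full_inj full) :
      M *m col_mx (const_mx 1) (- const_mx 1) = M *m (0 : 'cV_(m1 + m2)).
    by rewrite mul_row_col mulmxN !row_sum subrr mulmx0.
  move/matrixP=> H; have pE : p e0 \in p @: E by apply: imset_f.
  have := H (lshift m2 (enum_rank_in pE (p e0))) 0.
  by rewrite col_mxEu !mxE => /eqP; rewrite oner_eq0.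
have notfree : kermx M != 0.
  rewrite kermx_eq0 /row_free neq_ltn (leq_trans (n := m1 + m2)) //.
    by rewrite ltn_neqAle notfull rank_leq_col.
  have := card_imset_double Hp; have := card_imset_double Hq.
  by rewrite -/m1 -/m2 -/n; lia.
have /rowV0Pn[u /sub_kermxP uM u0] := notfree.
move: uM; rewrite mul_mx_row -[0]row_mx0 => /eq_row_mx[uM1 uM2].
pose z e := if e \in E then u 0 (enum_rank_in e0E e) else 0.
have zev i : z (ev i) = u 0 i by rewrite /z evE /ev enum_valK_in.
have sumz (L : finType) (r : T -> L) (l : L) :
    u *m \matrix_(i < n, j < #|r @: E|) (r (ev i) == enum_val j)%:R = 0 ->
    \sum_(e | r e == l) z e = 0.
  move=> ur; rewrite (bigID [in E]) /= addrC big1 ?add0r; last first.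
    by move=> e /andP[_ nE]; rewrite /z (negPf nE).
  have [lE|nlE] := boolP (l \in r @: E); last first.
    apply: big1 => e /andP[/eqP re Ee]; case/negP: nlE.
    by rewrite -re imset_f.
  move/matrixP/(_ 0 (enum_rank_in lE l)): ur; rewrite !mxE => ur; rewrite -[RHS]ur.
  rewrite (eq_bigl (fun e => (e \in E) && (r e == l))); last first.
    by move=> e; rewrite andbC.
  rewrite big_enum_val_cond [LHS]big_mkcond; apply: eq_bigr => i _.
  rewrite -/(ev i) zev !mxE enum_rankK_in //.
  by case: ifP; rewrite ?mulr1 ?mulr0.
exists z; split=> [e nE||l|l].
- by rewrite /z (negPf nE).
- by have /rV0Pn[i ui] := u0; exists (ev i); rewrite zev.
- exact: sumz.
- exact: sumz.
Qed.

(** * Integral points in the intersection of two crossing base polyhedra *)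

(** Uncrossing: the submodular inequality holds with equality at tight sets. *)
Lemma tight_crossing (V : finType) (R : numDomainType) (F : {set {set V}})
    (f : {set V} -> R) (y : V -> R) :
  crossing_family F -> crossing_submodular F f ->
  (forall U, U \in F -> \sum_(v in U) y v <= f U) ->
  crossing_family [set U in F | \sum_(v in U) y v == f U].
Proof.
move=> crossF subf feas U W; rewrite !inE => /andP[FU /eqP tU] /andP[FW /eqP tW].
move=> UW0 UWT; have [FI FJ] := crossF U W FU FW UW0 UWT.
rewrite FI FJ /=.
have := subf U W FU FW UW0 UWT; rewrite -tU -tW -sum_setU_setI => le_sum.
have leI := feas _ FI; have leU := feas _ FJ.
split; rewrite eq_le ?leI ?leU /=.
  by rewrite -(lerD2r (\sum_(v in U :|: W) y v)) (le_trans _ le_sum) // lerD2l.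
by rewrite -(lerD2l (\sum_(v in U :&: W) y v)) (le_trans _ le_sum) // lerD2r.
Qed.

Lemma sum_fibres_eq0 (T L : finType) (R : nmodType) (p : T -> L) (z : T -> R)
    (A : {set T}) :
  (forall l, \sum_(e | p e == l) z e = 0) ->
  (forall e e', p e = p e' -> (e \in A) = (e' \in A)) ->
  \sum_(e in A) z e = 0.
Proof.
move=> z0 satA; rewrite (partition_big_imset p) big1 // => _ /imsetP[e Ae ->].
rewrite -[RHS](z0 (p e)); apply: eq_bigl => e'.
by case: eqP => [/satA ->|]; rewrite ?andbF ?Ae.
Qed.

(** The sum over the atom of [e] is an integer, so [e] cannot be its only
    fractional coordinate. *)
Lemma fractional_partner (V : finType) (F : {set {set V}}) (y : V -> rat) (e : V) :
  crossing_family F -> \sum_v y v \is a Num.int ->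
  (forall U, U \in F -> \sum_(v in U) y v \is a Num.int) ->
  y e \isn't a Num.int ->
  exists2 e', e' \in [set v | y v \isn't a Num.int] &
    e' != e /\ atom F e' = atom F e.
Proof.
move=> crossF yV yF ye.
case: (boolP [exists e' in [set v | y v \isn't a Num.int],
               (e' != e) && (atom F e' == atom F e)]).
  by case/exists_inP=> e' Ee' /andP[ne /eqP pe]; exists e'.
move/exists_inPn=> H; case/negP: ye.
have := sum_atom_closed e crossF yV yF.
rewrite (bigD1 e) ?atom_id //= => int_sum.
rewrite -[y e](addrK (\sum_(i in atom F e | i != e) y i)) rpredB //.
apply: rpred_sum => e' /andP[ae ne]; apply: contraT => ye'.
by have := H e'; rewrite inE ye' ne eq_atom ae => /(_ isT).
Qed.

(** With two families the fractional coordinates of a point are the edges of a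
    bipartite graph on the atoms of the tight sets, which leaves a direction in
    which to move; with three families this fails. *)
Theorem crossing_intersection_integral (V : finType) (F G : {set {set V}})
    (f g : {set V} -> int) (c : int) (y0 : V -> rat) :
  crossing_family F -> crossing_submodular F f ->
  crossing_family G -> crossing_submodular G g ->
  \sum_v y0 v = c%:~R ->
  (forall U, U \in F -> \sum_(v in U) y0 v <= (f U)%:~R) ->
  (forall U, U \in G -> \sum_(v in U) y0 v <= (g U)%:~R) ->
  exists y : V -> int, [/\ \sum_v y v = c,
    forall U, U \in F -> \sum_(v in U) y v <= f U &
    forall U, U \in G -> \sum_(v in U) y v <= g U].
Proof.
move=> crossF subf crossG subg y0V y0F y0G.
have ratsub (H : {set {set V}}) (h : {set V} -> int) :
    crossing_submodular H h -> crossing_submodular H (fun U => (h U)%:~R : rat).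
  by move=> sub U W HU HW UW0 UWT; rewrite -!intrD ler_int sub.
(* Besides the two given systems, the inequalities bound each coordinate by
   consecutive integers and fix the total, written as two opposite
   inequalities; the boolean is the sign. *)
pose lo v := Num.floor (y0 v).
pose I : finType := ({U | U \in F} + {U | U \in G} + (V * bool + bool))%type.
pose sg (s : bool) : rat := (-1) ^+ s.
pose a (i : I) : V -> rat := match i with
  | inl (inl U) => fun v => (v \in val U)%:R
  | inl (inr U) => fun v => (v \in val U)%:R
  | inr (inl (w, s)) => fun v => sg s * (v == w)%:R
  | inr (inr s) => fun v => sg s
  end.
pose b (i : I) : rat := match i with
  | inl (inl U) => (f (val U))%:~R
  | inl (inr U) => (g (val U))%:~R
  | inr (inl (w, s)) => if s then - (lo w)%:~R else (lo w + 1)%:~R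
  | inr (inr s) => sg s * c%:~R
  end.
have dotU (U : {set V}) (y : V -> rat) :
    dot (fun v => (v \in U)%:R) y = \sum_(v in U) y v.
  rewrite [RHS]big_mkcond; apply: eq_bigr => v _.
  by case: ifP; rewrite ?mul1r ?mul0r.
have dot1 s w (y : V -> rat) : dot (fun v => sg s * (v == w)%:R) y = sg s * y w.
  rewrite /dot (bigD1 w) //= eqxx mulr1 big1 ?addr0 // => v /negPf->.
  by rewrite mulr0 mul0r.
have dotV s (y : V -> rat) : dot (fun v => sg s) y = sg s * \sum_v y v.
  by rewrite mulr_sumr.
have feas0 i : dot (a i) y0 <= b i.
  case: i => [[[U FU]|[U GU]]|[[w s]|s]] /=.
  - by rewrite dotU y0F.
  - by rewrite dotU y0G.
  - rewrite dot1 /sg; have /andP[] := floor_itv (y0 w); case: s => lew ltw.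
      by rewrite mulN1r lerN2.
    by rewrite mul1r ltW.
  - by rewrite dotV y0V.
have [|y [feas inty]] :=
  @polyhedron_descent _ _ _ a b (fun y => forall v, y v \is a Num.int) _ y0 feas0.
  move=> y feas; pose E := [set v | y v \isn't a Num.int].
  have [E0|E0] := eqVneq E set0.
    left=> v; have : v \notin E by rewrite E0 inE.
    by rewrite inE negbK.
  right.
  have yV : \sum_v y v = c%:~R.
    have := feas (inr (inr false)); have := feas (inr (inr true)).
    rewrite /= !dotV /sg !mulN1r !mul1r lerN2 => le1 le2.
    by apply/eqP; rewrite eq_le le1 le2.
  have yVint : \sum_v y v \is a Num.int by rewrite yV rpred_int.
  have yF U : U \in F -> \sum_(v in U) y v <= (f U)%:~R.
    by move=> FU; have := feas (inl (inl (exist _ U FU))); rewrite /= dotU.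
  have yG U : U \in G -> \sum_(v in U) y v <= (g U)%:~R.
    by move=> GU; have := feas (inl (inr (exist _ U GU))); rewrite /= dotU.
  pose tF := [set U in F | \sum_(v in U) y v == (f U)%:~R].
  pose tG := [set U in G | \sum_(v in U) y v == (g U)%:~R].
  have tFint U : U \in tF -> \sum_(v in U) y v \is a Num.int.
    by rewrite inE => /andP[_ /eqP->]; rewrite rpred_int.
  have tGint U : U \in tG -> \sum_(v in U) y v \is a Num.int.
    by rewrite inE => /andP[_ /eqP->]; rewrite rpred_int.
  have ctF : crossing_family tF := tight_crossing crossF (ratsub _ _ subf) yF.
  have ctG : crossing_family tG := tight_crossing crossG (ratsub _ _ subg) yG.
  have [z [zE [e ze] zF zG]] : exists z : V -> rat,
      [/\ forall e, e \notin E -> z e = 0,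
      exists e, z e != 0,
      forall l, \sum_(e | atom tF e == l) z e = 0 &
      forall l, \sum_(e | atom tG e == l) z e = 0].
    apply: null_fibre_sums_nontrivial => // e /[!inE] ye; exact: fractional_partner.
  have zV : \sum_v z v = 0.
    rewrite -[RHS](sum_fibres_eq0 (A := setT) zF) => [|? ? _]; last by rewrite !inE.
    by apply: eq_bigl => v; rewrite inE.
  (* Along [z] the coordinate [e] moves towards one of its two bounds. *)
  exists z, (inr (inl (e, z e < 0))); split; last first.
    by rewrite /= dot1 /sg -normrEsign normr_gt0.
  case=> [[[U FU]|[U GU]]|[[w s]|s]] /=.
  - rewrite !dotU => tU; apply: sum_fibres_eq0 zF _ => v w /eqP.
    by rewrite eq_atom => /atomP; apply; rewrite inE FU tU eqxx.
  - rewrite !dotU => tU; apply: sum_fibres_eq0 zG _ => v w /eqP.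
    by rewrite eq_atom => /atomP; apply; rewrite inE GU tU eqxx.
  - rewrite !dot1 => tw; rewrite zE ?mulr0 // inE negbK.
    have -> : y w = sg s * (sg s * y w) by rewrite mulrA -expr2 sqrr_sign mul1r.
    by rewrite tw /sg; case: (s); rewrite ?mulN1r ?mul1r ?opprK rpred_int.
  - by rewrite !dotV zV mulr0.
pose yi v := Num.floor (y v).
have yiE v : y v = (yi v)%:~R by apply/eqP; rewrite eq_sym -intrEfloor inty.
have sumE (P : pred V) : \sum_(v | P v) y v = (\sum_(v | P v) yi v)%:~R.
  by rewrite rmorph_sum; apply: eq_bigr.
exists yi; split.
- have := feas (inr (inr false)); have := feas (inr (inr true)).
  rewrite /= !dotV /sg !mulN1r !mul1r lerN2 sumE !ler_int => le1 le2.
  by apply/eqP; rewrite eq_le le1 le2.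
- by move=> U FU; have := feas (inl (inl (exist _ U FU))); rewrite /= dotU sumE ler_int.
- by move=> U GU; have := feas (inl (inr (exist _ U GU))); rewrite /= dotU sumE ler_int.
Qed.
(** * Sets of arcs with prescribed net outflow *)

Lemma deg_outU1 (D : digraph) (J : {set darc D}) (a : darc D) (U : {set vert D}) :
  a \notin J ->
  deg_out (a |: J) U = ((src a \in U) && (tgt a \notin U) + deg_out J U)%N.
Proof.
move=> aJ; rewrite /deg_out setIUr cardsU.
have -> : cut_out U :&: [set a] :&: (cut_out U :&: J) = set0.
  by apply/setP=> x; rewrite !inE; case: (eqVneq x a) => [->|];
    rewrite ?(negPf aJ) ?andbF.
rewrite cards0 subn0; congr (_ + _)%N; have [aU|aU] := boolP (_ && _).
  by rewrite (setIidPr _) ?cards1 // sub1set inE.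
by apply: eq_card0 => x; rewrite !inE; case: (eqVneq x a) => [->|];
    rewrite ?(negPf aU) ?andbF.
Qed.

Lemma deg_inC (D : digraph) (J : {set darc D}) (U : {set vert D}) :
  deg_in J (~: U) = deg_out J U.
Proof.
by congr #|_ :&: J|; apply/setP=> a; rewrite !inE negbK.
Qed.

Lemma deg_outC (D : digraph) (J : {set darc D}) (U : {set vert D}) :
  deg_out J (~: U) = deg_in J U.
Proof. by rewrite -deg_inC setCK. Qed.

Lemma deg_inU1 (D : digraph) (J : {set darc D}) (a : darc D) (U : {set vert D}) :
  a \notin J ->
  deg_in (a |: J) U = ((src a \notin U) && (tgt a \in U) + deg_in J U)%N.
Proof. by move=> aJ; rewrite -!deg_outC deg_outU1 // !inE negbK. Qed.

Lemma deg_out_submodular (D : digraph) (J : {set darc D}) (X Y : {set vert D}) :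
  (deg_out J (X :&: Y) + deg_out J (X :|: Y) <= deg_out J X + deg_out J Y)%N.
Proof.
have [n] := ubnP #|J|; elim: n J => // n IHn J ltn.
have [->|/set0Pn[a aJ]] := eqVneq J set0.
  by rewrite /deg_out !setI0 !cards0.
have aJ' : a \notin J :\ a by rewrite !inE eqxx.
rewrite -(setD1K aJ) !deg_outU1 //; have := IHn (J :\ a).
rewrite -ltnS (leq_trans _ ltn) ?ltnS; last by rewrite (cardsD1 a J) aJ.
move=> /(_ isT); rewrite !inE.
case: (src a \in X); case: (src a \in Y);
  by case: (tgt a \in X); case: (tgt a \in Y) => /=; lia.
Qed.

(** Induction on [J]: an arc [a] can either be left out of [K], keeping the
    demand [y], or be put into [K], correcting the demand at its two ends.  If
    leaving it out violates the condition at [X], then [X] is tight and [a]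
    leaves [X]; if putting it in violates the condition at [Y], then [Y] is
    tight and [a] enters [Y].  Both cannot occur: [a] leaves [X], but neither
    [X :&: Y] nor [X :|: Y], so the submodular inequality of the cut function
    is strict at [X] and [Y], while tightness forces equality. *)
Lemma net_outflow_realizable (D : digraph) (J : {set darc D}) (y : vert D -> int) :
  \sum_v y v = 0 ->
  (forall U : {set vert D}, \sum_(v in U) y v <= (deg_out J U)%:Z) ->
  exists2 K : {set darc D}, K \subset J &
    forall U : {set vert D},
      \sum_(v in U) y v = (deg_out K U)%:Z - (deg_in K U)%:Z.
Proof.
have [n] := ubnP #|J|; elim: n J y => // n IHn J y ltn yV ybound.
have [J0|/set0Pn[a aJ]] := eqVneq J set0.
  exists set0; rewrite ?sub0set // => U.
  have H (W : {set vert D}) : \sum_(v in W) y v <= 0.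
    by have := ybound W; rewrite J0 /deg_out setI0 cards0.
  have := H U; have := H (~: U); rewrite sum_setC yV /deg_out /deg_in !setI0 cards0.
  by rewrite subrr sub0r oppr_le0 => ge0 le0; apply/eqP; rewrite eq_le le0 ge0.
pose J' := J :\ a; have aJ' : a \notin J' by rewrite !inE eqxx.
have JE : J = a |: J' by rewrite setD1K.
have ltJ' : (#|J'| < n)%N.
  by rewrite -ltnS (leq_trans _ ltn) // ltnS (cardsD1 a J) aJ.
have bound (U : {set vert D}) : \sum_(v in U) y v <=
    ((src a \in U) && (tgt a \notin U))%:Z + (deg_out J' U)%:Z.
  by rewrite -PoszD -deg_outU1 // -JE.
pose y' v := y v - (v == src a)%:Z + (v == tgt a)%:Z.
have y'E (U : {set vert D}) :
    \sum_(v in U) y' v = \sum_(v in U) y v - (src a \in U)%:Z + (tgt a \in U)%:Z.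
  have ind w : \sum_(v in U) (v == w)%:Z = (w \in U)%:Z.
    have [wU|wU] := boolP (w \in U).
      by rewrite (bigD1 w) //= eqxx big1 // => v /andP[_ /negPf->].
    by apply: big1 => v vU; case: eqP vU wU => // -> ->.
  by rewrite big_split sumrB !ind.
have y'V : \sum_v y' v = 0.
  have := y'E setT; rewrite !inE addrNK.
  by under eq_bigl do rewrite inE; under [X in _ = X]eq_bigl do rewrite inE; rewrite yV.
case: (boolP [forall U : {set vert D}, \sum_(v in U) y v <= (deg_out J' U)%:Z])
  => [/forallP ok|].
  have [K sK KE] := IHn J' y ltJ' yV ok.
  by exists K => //; rewrite JE (subset_trans sK) // subsetUr.
rewrite negb_forall => /existsP[X]; rewrite -ltNge => bigX.
case: (boolP [forall U : {set vert D}, \sum_(v in U) y' v <= (deg_out J' U)%:Z])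
  => [/forallP ok|].
  have [K sK KE] := IHn J' y' ltJ' y'V ok.
  have aK : a \notin K by apply: contra aJ'; apply: (subsetP sK).
  exists (a |: K); first by rewrite JE setUS.
  move=> U; rewrite deg_outU1 // deg_inU1 // !PoszD.
  have := KE U; rewrite y'E; case: (src a \in U); case: (tgt a \in U) => /=; lia.
rewrite negb_forall => /existsP[Y]; rewrite -ltNge y'E => bigY.
have /andP[sX tX] : (src a \in X) && (tgt a \notin X).
  by apply: contraLR bigX => /negPf aX; have := bound X; rewrite aX add0r -leNgt.
have [sY tY] : src a \notin Y /\ tgt a \in Y.
  have := bound Y; move: bigY.
  by case: (src a \in Y); case: (tgt a \in Y) => //=; lia.
pose S (U : {set vert D}) : int := \sum_(v in U) y v.
have SXY : S (X :&: Y) + S (X :|: Y) = S X + S Y := sum_setU_setI y X Y.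
have := deg_out_submodular J' X Y.
have : S (X :&: Y) <= _ := bound (X :&: Y).
have : S (X :|: Y) <= _ := bound (X :|: Y).
move: bigX bigY; rewrite -/(S X) -/(S Y) !inE sX tY (negPf tX) (negPf sY) /=.
clearbody S; lia.
Qed.

(** * Flips *)

Lemma sum_net_outflow (R : nzRingType) (D : digraph) (U : {set vert D}) :
  \sum_(v in U) \sum_a ((src a == v)%:R - (tgt a == v)%:R) =
  (deg_out [set: darc D] U)%:R - (deg_in [set: darc D] U)%:R :> R.
Proof.
have ind w : \sum_(v in U) (w == v)%:R = (w \in U)%:R :> R.
  have [wU|wU] := boolP (w \in U).
    rewrite (bigD1 w) //= eqxx big1 ?addr0 // => v /andP[_].
    by rewrite eq_sym => /negPf->.
  by apply: big1 => v vU; case: eqP wU => // ->; rewrite vU.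
rewrite exchange_big /= /deg_out /deg_in !setIT -!sum1_card !natr_sum.
rewrite [X in _ = X - _]big_mkcond [X in _ = _ - X]big_mkcond -sumrB.
apply: eq_bigr => a _; rewrite sumrB !ind !inE.
by case: (src a \in U); case: (tgt a \in U); rewrite ?subrr ?subr0.
Qed.

Theorem theorem2 (tau k : nat) (D : digraph)
    (C : {set {set vert D}}) (f : {set vert D} -> int) :
  (1 <= tau)%N -> (1 <= k)%N ->
  (forall U : {set vert D}, U != set0 -> U \proper [set: vert D] ->
     (deg_out [set: darc D] U)%:R
       + (tau%:R / k%:R - 1) * (deg_in [set: darc D] U)%:R >= tau%:R :> rat) ->
  crossing_family C ->
  crossing_submodular C f ->
  (forall U : {set vert D}, U \in C ->
     (f U)%:~R >= k%:R / tau%:R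
       * ((deg_out [set: darc D] U)%:R - (deg_in [set: darc D] U)%:R) :> rat) ->
  exists J : {set darc D},
    arc_connected_flip k J /\
    (forall U : {set vert D}, U \in C ->
       f U >= (deg_out J U)%:Z - (deg_in J U)%:Z).
Proof.
move=> tau1 k1 cutD crossC subf flow_f.
pose A := [set: darc D].
pose G : {set {set vert D}} := [set U | (U != set0) && (U != setT)].
pose g (U : {set vert D}) : int := (deg_out A U)%:Z - k%:Z.
(* If all arcs carry flow [k / tau], then [y0] is the net outflow; it is
   meaningful even when [k / tau] exceeds 1. *)
pose y0 (v : vert D) : rat :=
  k%:R / tau%:R * \sum_a ((src a == v)%:R - (tgt a == v)%:R).
have y0E (U : {set vert D}) : \sum_(v in U) y0 v =
    k%:R / tau%:R * ((deg_out A U)%:R - (deg_in A U)%:R).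
  by rewrite -mulr_sumr sum_net_outflow.
have sumT (R : nmodType) (h : vert D -> R) : \sum_(v in setT) h v = \sum_v h v.
  by apply: eq_bigl => v; rewrite inE.
have setC_eq0 (U : {set vert D}) : (~: U == set0) = (U == setT).
  by rewrite -setCT (inj_eq (can_inj (@setCK _))).
have setC_eqT (U : {set vert D}) : (~: U == setT) = (U == set0).
  by rewrite -setC0 (inj_eq (can_inj (@setCK _))).
have crossG : crossing_family G.
  move=> U W; rewrite !inE => /andP[U0 UT] /andP[W0 WT] I0 JT.
  rewrite I0 JT andbT; split.
    by apply: contraNneq UT => E; rewrite -subTset -E subsetIl.
  by apply: contraNneq U0 => E; rewrite -subset0 -E subsetUl.
have subg : crossing_submodular G g.
  move=> U W _ _ _ _; have := deg_out_submodular A U W; rewrite /g; lia.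
have y0T : \sum_v y0 v = 0%:~R.
  have outT : deg_out A setT = 0%N by apply: eq_card0 => a; rewrite !inE andbF.
  have inT : deg_in A setT = 0%N by apply: eq_card0 => a; rewrite !inE.
  by rewrite -sumT y0E outT inT subrr mulr0.
have y0G U : U \in G -> \sum_(v in U) y0 v <= (g U)%:~R.
  rewrite inE => /andP[U0 UT]; rewrite y0E /g.
  have := cutD (~: U); rewrite deg_outC deg_inC properT.
  rewrite setC_eq0 UT setC_eqT U0 => /(_ isT isT).
  have tau0 : 0 < tau%:R :> rat by rewrite ltr0n.
  have k0 : 0 < k%:R :> rat by rewrite ltr0n.
  (* Scaling the cut condition of [~: U] by [k / tau] gives the bound [g U]. *)
  rewrite -(ler_pM2l (divr_gt0 k0 tau0)) -/A => le_tau.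
  rewrite intrB -subr_ge0; rewrite -subr_ge0 in le_tau.
  congr (0 <= _): le_tau; rewrite -!pmulrn; field.
  by rewrite !gt_eqF.
have y0C U : U \in C -> \sum_(v in U) y0 v <= (f U)%:~R.
  by move=> CU; rewrite y0E flow_f.
have [y [yV yf yg]] :=
  crossing_intersection_integral crossC subf crossG subg y0T y0C y0G.
have [|J _ JE] := net_outflow_realizable (J := A) yV.
  move=> U; have [->|U0] := eqVneq U set0; first by rewrite big_set0.
  have [->|UT] := eqVneq U setT; first by rewrite sumT yV.
  by rewrite (le_trans (yg U _)) ?inE ?U0 // /g gerBl.
exists J; split; last by move=> U CU; rewrite -JE yf.
apply/arc_connected_flipP => U U0; rewrite properT => UT.
have := yg (~: U); rewrite JE inE /g !deg_outC !deg_inC -/A.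
rewrite setC_eq0 UT setC_eqT U0 => /(_ isT); lia.
Qed.
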